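(* Let $n \geq 4$ be an even integer, let $W_n$ be the wheel graph on $n$ vertices with vertices labelled as described in the context, let $D$ be its distance matrix, and let $\widetilde{L}$ be the special Laplacian of $W_n$. Define $w \in \mathbb{R}^n$ by $w := \frac{1}{4}(5-n, 1, \dotsc, 1)'$. Then $D$ is invertible and \[ D^{-1} = -\frac{1}{2}\widetilde{L} + \frac{4}{n-1} w w'. \]
   Context: The wheel graph $W_n$ ($n\ge 4$) consists of a cycle $C_{n-1}$ on $n-1$ vertices together with one additional vertex (the hub) adjacent to all vertices of the cycle. Label the hub $1$ and the cycle vertices $2,3,\dotsc,n$ in cyclic order around the cycle. The distance $d_{ij}$ is the length of a shortest path between vertices $i$ and $j$, and the distance matrix is $D=[d_{ij}]$ (zero diagonal). For $c=(c_1,\dotsc,c_m)$, $\mathrm{Circ}(c)$ denotes the $m\times m$ circulant matrix whose first row is $(c_1,\dotsc,c_m)$ and whose $k$-th row is the first row cyclically shifted $k-1$ places to the right, i.e. its $(i,j)$ entry is $c_{((j-i) \bmod m)+1}$. With this labelling, $D=\begin{bmatrix}0 & \mathbf{1}'\\ \mathbf{1} & \mathrm{Circ}(0,1,2,\dotsc,2,1)\end{bmatrix}$ where the circulant is $(n-1)\times(n-1)$. Special Laplacian: for $n\ge4$ even and $k\in\{1,\dotsc,\frac n2-1\}$, let $c^k\in\mathbb{R}^{n-1}$ have $c^k_j=1$ if $j=k+1$ or $j=n-k$ and $c^k_j=0$ otherwise, and let $C_k=\mathrm{Circ}(c^k)$ (of order $n-1$). Then \[\widetilde{L} := \frac{n-1}{2}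 I - \frac12\begin{bmatrix}0 & \mathbf{1}'\\ \mathbf{1} & 0\end{bmatrix} + \sum_{k=1}^{\frac n2 -1} (-1)^k \frac{(n-1)-2k}{2}\begin{bmatrix}0&0\\0&C_k\end{bmatrix},\] an $n\times n$ matrix; $\mathbf{1}$ denotes the all-ones vector and $I$ the identity. *)

(* Defs.v *)
From mathcomp Require Import all_boot all_order all_algebra.
Set Implicit Arguments.
Unset Strict Implicit.
Unset Printing Implicit Defensive.
Import GRing.Theory Num.Theory.
Local Open Scope ring_scope.

(* [k] edges join the [k.+1] pairwise distinct vertices of [x :: p]. *)
Definition has_path (T : finType) (e : rel T) (x y : T) (k : nat) : bool :=
  [exists p : k.-tuple T,
    [&& path e x p, uniq (x :: p) & last x p == y]].

(* The least [k] such that a path of length [k] joins [x] to [y].  A path has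
   fewer than [#|T|] edges; the value is [#|T|] if [x] and [y] are not
   connected. *)
Definition gdist (T : finType) (e : rel T) (x y : T) : nat :=
  find (has_path e x y) (iota 0 #|T|).

Definition cycle_adj (m : nat) : rel 'I_m :=
  fun i j => (ordS i == j) || (ordS j == i).

(* Vertices and matrix indices of [W_n] live in ['I_(1 + n.-1)], which has [n]
   elements for [0 < n]: index [0] is the hub, and [rshift 1 i] with
   [i : 'I_n.-1] are the cycle vertices in cyclic order. *)
Definition wheel_adj (n : nat) : rel 'I_(1 + n.-1) :=
  fun u v =>
    match split u, split v with
    | inl _, inl _ => false
    | inl _, inr _ | inr _, inl _ => true
    | inr i, inr j => cycle_adj i j
    end.

Definition wheel_dist_mx (R : realFieldType) (n : nat) : 'M[R]_(1 + n.-1) :=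
  \matrix_(i, j) (gdist (wheel_adj (n := n)) i j)%:R.

Definition ord_subm (m : nat) (j i : 'I_m) : 'I_m :=
  Ordinal (ltn_pmod (j + (m - i)) (leq_ltn_trans (leq0n i) (ltn_ord i))).

Definition Circ (R : Type) (m : nat) (c : 'rV[R]_m) : 'M[R]_m :=
  \matrix_(i, j) c ord0 (ord_subm j i).

(* [j.+1] is the position of the entry [j : 'I_n.-1] when counting from 1. *)
Definition circ_vec (R : realFieldType) (n k : nat) : 'rV[R]_(n.-1) :=
  \row_j ((j.+1 == k.+1) || (j.+1 == n - k))%N%:R.

Definition special_laplacian (R : realFieldType) (n : nat) :
    'M[R]_(1 + n.-1) :=
  ((n%:R - 1) / 2)%:M
  - 2^-1 *: block_mx 0 (const_mx 1) (const_mx 1) 0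
  + \sum_(1 <= k < n./2)
      ((-1) ^+ k * (((n%:R - 1) - 2 * k%:R) / 2)) *:
        block_mx 0 0 0 (Circ (circ_vec R n k)).

Definition wheel_w (R : realFieldType) (n : nat) : 'cV[R]_(1 + n.-1) :=
  4^-1 *: col_mx (const_mx (5 - n%:R)) (const_mx 1).

(* Main.v *)
Require Import Defs.
From mathcomp Require Import all_boot all_order all_algebra.
From mathcomp Require Import zify ring lra.
Import GRing.Theory Num.Theory.
Local Open Scope ring_scope.

(** Put [m = n - 1], which is odd.  The cycle block of the special Laplacian is
    the circulant [M] with entry [g d = (-1)^d (m - 2 d) / 2] at every offset
    [0 <= d < m]: oddness of [m] makes the two halves [d = k] and [d = m - k]
    given by the same formula.  The cycle block of [D] is [2 J - 2 I - A], with
    [A] the adjacency matrix of the cycle, and since [g] is an alternating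
    affine function, [g d + (g (d - 1) + g (d + 1)) / 2] vanishes except at the
    wrap-around, i.e. [(I + A / 2) M = I].  Summing the columns of this
    identity shows that the columns of [M] add up to [1 / 2], and the claimed
    inverse follows by block multiplication. *)

(** * Distances in graphs of diameter at most two *)

Section GraphDistance.
Variables (T : finType) (e : rel T).

Lemma has_path0 x y : has_path e x y 0 = (x == y).
Proof.
apply/existsP/idP => [[p]|/eqP ->]; first by rewrite tuple0.
by exists [tuple]; rewrite /= eqxx.
Qed.

Lemma has_path1 x y : has_path e x y 1 = (x != y) && e x y.
Proof.
apply/existsP/idP => [[p]|/andP[xy exy]].
  case/tupleP: p => z p; rewrite tuple0 /= !andbT inE.
  by case/and3P => exz xz /eqP <-; rewrite xz.
by exists [tuple y]; rewrite /= exy inE xy eqxx.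
Qed.

Lemma has_path2 x y z : x != z -> z != y -> x != y -> e x z -> e z y ->
  has_path e x y 2.
Proof.
move=> xz zy xy exz ezy; apply/existsP; exists [tuple z; y].
by rewrite /= exz ezy !inE (negPf xz) (negPf xy) zy eqxx.
Qed.

(** More than two vertices let the search reach length 2. Irreflexivity makes a common neighbour
    differ from both ends, so it gives a genuine path. *)
Lemma gdist_diam2 x y : (2 < #|T|)%N -> irreflexive e ->
  (x != y -> ~~ e x y -> exists2 z, e x z & e z y) ->
  gdist e x y = if x == y then 0 else if e x y then 1 else 2.
Proof.
rewrite /gdist => T_gt2 irr nbr.
have neq u v : e u v -> u != v by apply: contraTneq => ->; rewrite irr.
case: #|T| T_gt2 => [|[|[|k]]] // _ /=.
rewrite has_path0 has_path1; case: eqP => //= /eqP xy.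
case: (boolP (e x y)) => //= nexy; have [z xz zy] := nbr xy nexy.
by rewrite (has_path2 x y z) // neq.
Qed.

End GraphDistance.

(** * Neighbours and offsets modulo [m] on the cycle *)

Section Cycle.
Variable m : nat.
Implicit Types i j k : 'I_m.

Lemma val_ordS i : ordS i = (if i.+1 == m then 0 else i.+1) :> nat.
Proof.
move: (ltn_ord i) => /=; case: eqP => [->|]; first by rewrite modnn.
by move=> *; rewrite modn_small; lia.
Qed.

Lemma val_ord_pred i : ord_pred i = (if i == 0 :> nat then m.-1 else i.-1) :> nat.
Proof.
move: (ltn_ord i) => /=; case: eqP => ? ?; first by rewrite modn_small; lia.
have -> : ((i + m).-1 = i.-1 + m)%N by lia.
by rewrite modnDr modn_small; lia.
Qed.

Lemma val_ord_subm k i :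
  ord_subm k i = (if i <= k then k - i else k + m - i)%N :> nat.
Proof.
move: (ltn_ord i) (ltn_ord k) => /= im km; case: leqP => ik.
  have -> : (k + (m - i) = k - i + m)%N by lia.
  by rewrite modnDr modn_small; lia.
by rewrite modn_small; lia.
Qed.

Lemma ord_subm_eq0 k i : (ord_subm k i == 0 :> nat) = (i == k).
Proof.
rewrite val_ord_subm -[i == k]val_eqE /=.
by move: (ltn_ord i) (ltn_ord k); case: ifP; lia.
Qed.

(** A circulant entry depends on column minus row, so advancing the row lowers the offset by one,
    with wrap-around at 0. *)
Lemma ord_subm_ordS k i : ord_subm k (ordS i) =
  (if ord_subm k i == 0 :> nat then m.-1 else (ord_subm k i).-1) :> nat.
Proof.
rewrite !val_ord_subm val_ordS.
by move: (ltn_ord i) (ltn_ord k); do ![case: ifP]; lia.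
Qed.

Lemma ord_subm_ord_pred k i : ord_subm k (ord_pred i) =
  (if ord_subm k i == m.-1 :> nat then 0%N else (ord_subm k i).+1) :> nat.
Proof.
rewrite !val_ord_subm val_ord_pred.
by move: (ltn_ord i) (ltn_ord k); do ![case: ifP]; lia.
Qed.

Lemma cycle_adjE i j : cycle_adj i j = (j == ordS i) || (j == ord_pred i).
Proof. by rewrite /cycle_adj eq_sym (can2_eq (@ordSK m) (@ord_predK m)). Qed.

Lemma ordS_neq_pred i : (2 < m)%N -> ordS i != ord_pred i.
Proof.
move=> m_gt2; rewrite -val_eqE [val (ordS i)]val_ordS [val (ord_pred i)]val_ord_pred.
by move: (ltn_ord i); do ![case: ifP]; lia.
Qed.

Lemma cycle_adj_irr i : (2 < m)%N -> cycle_adj i i = false.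
Proof.
move=> m_gt2; apply/negbTE; rewrite /cycle_adj orbb -val_eqE [val (ordS i)]val_ordS.
by move: (ltn_ord i) => /=; case: ifP; lia.
Qed.

Lemma sum_cycle_adj (R : pzRingType) i (F : 'I_m -> R) : (2 < m)%N ->
  \sum_j (cycle_adj i j)%:R * F j = F (ordS i) + F (ord_pred i).
Proof.
move=> m_gt2; have ne := ordS_neq_pred i m_gt2.
rewrite (bigD1 (ordS i)) //= (bigD1 (ord_pred i)) 1?eq_sym //=.
rewrite !cycle_adjE !eqxx orbT /= !mul1r big1 ?addr0 // => j /andP[/negPf j1 /negPf j2].
by rewrite cycle_adjE j1 j2 mul0r.
Qed.

End Cycle.

Lemma wheel_gdist (n : nat) (u v : 'I_(1 + n.-1)) : (4 <= n)%N ->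
  gdist (@wheel_adj n) u v =
    if u == v then 0%N else if wheel_adj u v then 1%N else 2%N.
Proof.
move=> n_ge4; apply: gdist_diam2; first by rewrite card_ord; lia.
  by move=> x; rewrite /wheel_adj; case: (split x) => // i; rewrite cycle_adj_irr //; lia.
(* The hub is the common neighbour: two distinct non-adjacent vertices both lie on the cycle. *)
move=> uv nadj; exists (lshift n.-1 (ord0 : 'I_1)); move: uv nadj.
  rewrite /wheel_adj -[lshift _ _]/(unsplit (inl ord0)) unsplitK.
  case: (splitP u) => [i ui|//]; case: (splitP v) => [j vj|//].
  by rewrite -val_eqE /= ui vj !ord1.
rewrite /wheel_adj -[lshift _ _]/(unsplit (inl ord0)) unsplitK.
case: (splitP v) => [j vj|//]; case: (splitP u) => [i ui|//].
by rewrite -val_eqE /= ui vj !ord1.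
Qed.

(** * Block forms of the matrices and their product *)

Section WheelInverse.
Variables (R : realFieldType) (n : nat).
Hypotheses (n_ge4 : (4 <= n)%N) (n_even : ~~ odd n).

Local Notation m := n.-1.

Let m_gt2 : (2 < m)%N. Proof. by lia. Qed.
Let natm : m%:R = n%:R - 1 :> R.
Proof. by rewrite -{2}(@prednK n) -?natr1 ?addrK //; lia. Qed.
Let natm_neq0 : n%:R - 1 != 0 :> R.
Proof. by rewrite -natm pnatr_eq0; lia. Qed.

Definition cycle_dist_mx : 'M[R]_m :=
  \matrix_(i, j) (2 - 2 * (i == j)%:R - (cycle_adj i j)%:R).

Lemma wheel_dist_mxE :
  wheel_dist_mx R n = block_mx 0 (const_mx 1) (const_mx 1) cycle_dist_mx.
Proof.
have adj (s t : 'I_1 + 'I_m) : wheel_adj (n := n) (unsplit s) (unsplit t) =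
    match s, t with
    | inl _, inl _ => false
    | inl _, inr _ | inr _, inl _ => true
    | inr i, inr j => cycle_adj i j
    end by rewrite /wheel_adj !unsplitK.
apply/matrixP => u v; rewrite -[u]splitK -[v]splitK mxE wheel_gdist //.
rewrite adj (inj_eq (can_inj (@unsplitK _ _))).
case: (split u) => i; case: (split v) => j /=.
- by rewrite block_mxEul mxE !ord1.
- by rewrite block_mxEur mxE.
- by rewrite block_mxEdl mxE.
rewrite block_mxEdr mxE -[inr i == inr j]/(i == j).
case: eqP => [->|_]; first by rewrite cycle_adj_irr //=; lra.
by case: cycle_adj => /=; lra.
Qed.

(** The function [g] of the opening comment. *)
Definition lap_coef (d : nat) : R := (-1) ^+ d * ((n%:R - 1 - 2 * d%:R) / 2).

Definition cycle_lap_mx : 'M[R]_m := \matrix_(i, j) lap_coef (ord_subm j i).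

(** Passing from [d] to [m - d] negates both the sign, as [m] is odd, and the factor [m - 2 d]. *)
Lemma lap_coef_sub d : (d <= m)%N -> lap_coef (m - d) = lap_coef d.
Proof.
move=> dm; rewrite /lap_coef natrB // natm -signr_odd oddB //.
have -> : odd m by lia.
by rewrite -(signr_odd R d); case: odd => /=; rewrite ?expr0 ?expr1; lra.
Qed.

Lemma sum_circ_vec (j : 'I_m) :
  \sum_(1 <= k < n./2) lap_coef k * circ_vec R n k ord0 j =
  if j == 0 :> nat then 0 else lap_coef j.
Proof.
have jm := ltn_ord j.
have [j0|j0] := eqVneq (j : nat) 0%N.
  rewrite big_nat big1 // => k k_range; rewrite mxE.
  by rewrite (_ : _ || _ = false) ?mulr0 //; lia.
(* The only [k] whose circulant is nonzero at offset [j]. *)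
pose k0 := minn j (m - j).
have k0_range : (k0 \in index_iota 1 n./2) by rewrite mem_index_iota; lia.
rewrite (bigD1_seq k0) ?iota_uniq //= big_seq_cond big1 => [|k].
  rewrite mxE (_ : _ || _) ?mulr1 ?addr0; last by lia.
  have [->|->] : k0 = j \/ k0 = (m - j)%N by lia.
    by [].
  by rewrite lap_coef_sub //; lia.
rewrite mem_index_iota => k_range; rewrite mxE.
by rewrite (_ : _ || _ = false) ?mulr0 //; lia.
Qed.

Lemma special_laplacianE : special_laplacian R n =
  block_mx ((n%:R - 1) / 2)%:M (const_mx (- 2^-1)) (const_mx (- 2^-1))
           cycle_lap_mx.
Proof.
rewrite /special_laplacian (@scalar_mx_block _ 1 m).
rewrite scale_block_mx opp_block_mx add_block_mx.
have -> : \sum_(1 <= k < n./2)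
      ((-1) ^+ k * (((n%:R - 1) - 2 * k%:R) / 2)) *:
        block_mx 0 0 0 (Circ (circ_vec R n k)) =
   block_mx 0 0 0 (\sum_(1 <= k < n./2) lap_coef k *: Circ (circ_vec R n k))
   :> 'M_(1 + m, 1 + m).
  elim/big_rec2: _ => [|k A B _ ->]; first by rewrite block_mx_const.
  by rewrite scale_block_mx add_block_mx !scaler0 !addr0.
rewrite add_block_mx; congr block_mx; apply/matrixP => i j.
- by rewrite !mxE; lra.
- by rewrite !mxE; lra.
- by rewrite !mxE; lra.
rewrite mxE [X in _ + X]summxE.
under eq_bigr do rewrite mxE [Circ _ _ _]mxE.
rewrite sum_circ_vec ord_subm_eq0 !mxE.
have [->|_] := eqVneq i j; last by rewrite /= ?mulr0n; lra.
(* The circulants vanish at offset 0; the scalar term supplies the missing [lap_coef 0]. *)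
have /eqP -> : ord_subm j j == 0 :> nat by rewrite ord_subm_eq0.
by rewrite /lap_coef expr0 /= mulr1n; lra.
Qed.

(** Twice the identity [(I + A / 2) M = I]. Away from the wrap-around, the alternating sign turns
    the left side into a second difference of an affine function. *)
Lemma lap_coef_rec (i k : 'I_m) :
  2 * cycle_lap_mx i k + (cycle_lap_mx (ordS i) k + cycle_lap_mx (ord_pred i) k)
  = 2 * (i == k)%:R.
Proof.
rewrite !mxE ord_subm_ordS ord_subm_ord_pred -ord_subm_eq0.
move: (nat_of_ord (ord_subm k i)) (ltn_ord (ord_subm k i)) => d dm.
have natP : m.-1%:R = n%:R - 2 :> R.
  by rewrite -subn1 natrB ?natm; [lra | lia].
have sgnP : (-1) ^+ m.-1 = 1 :> R by rewrite -signr_odd (_ : odd _ = false) //; lia.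
rewrite /lap_coef; case: d dm => [|d] dm /=.
  (* At offset 0 the neighbouring offsets are [m - 1] and 1; [g (m - 1)] exceeds the affine
     continuation [g (-1)] by 2, which is the diagonal entry. *)
  rewrite (_ : 0%N == m.-1 = false); last by lia.
  by rewrite sgnP natP !(expr0, expr1); lra.
case: eqP => [dE|_]; last by rewrite -!natr1 !exprS; ring.
(* At offset [m - 1] the next offset wraps to 0, but [g m = g 0], so the sum still vanishes. *)
have -> : (d.+1%:R = n%:R - 2 :> R) by rewrite dE.
have dR : d%:R = n%:R - 3 :> R.
  by apply: (@addIr _ 1); rewrite natr1 dE natP; ring.
have sd : (-1) ^+ d = -1 :> R by rewrite -signr_odd (_ : odd d) //; lia.
by rewrite dR exprS sd expr0; field.
Qed.

(** Both shifts permute the rows, so summing [lap_coef_rec] over [i] gives four times the column sum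
    equal to 2. *)
Lemma sum_cycle_lap (k : 'I_m) : \sum_i cycle_lap_mx i k = 2^-1.
Proof.
have : \sum_i (2 * cycle_lap_mx i k
    + (cycle_lap_mx (ordS i) k + cycle_lap_mx (ord_pred i) k)) = 2.
  under eq_bigr do rewrite lap_coef_rec.
  rewrite (bigD1 k) //= eqxx big1 ?addr0 ?mulr1 // => i /negPf ->.
  by rewrite mulr0.
rewrite !big_split -mulr_sumr /=.
rewrite -(reindex_inj (@ordS_inj m) (P := xpredT) (F := fun i => cycle_lap_mx i k)) /=.
rewrite -(reindex_inj (@ord_pred_inj m) (P := xpredT) (F := fun i => cycle_lap_mx i k)) /=.
by lra.
Qed.

(** Isolates the total of [F], known from column sums, from the combination that [lap_coef_rec]
    evaluates. *)
Lemma sum_cycle_dist (F : 'I_m -> R) (i : 'I_m) :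
  \sum_j cycle_dist_mx i j * F j =
  2 * (\sum_j F j) - 2 * F i - (F (ordS i) + F (ord_pred i)).
Proof.
rewrite -(sum_cycle_adj _ _ i F) // mulr_sumr.
have -> : 2 * F i = \sum_j 2 * (i == j)%:R * F j.
  rewrite (bigD1 i) //= eqxx big1 ?addr0 ?mulr1 // => j.
  by rewrite eq_sym => /negPf ->; rewrite mulr0 mul0r.
by rewrite -!sumrB; apply: eq_bigr => j _; rewrite mxE; ring.
Qed.

(** The claimed inverse in blocks; the corner is [((5 - n)^2 - (n - 1)^2) / (4 (n - 1))]
    simplified. *)
Definition wheel_inv_mx : 'M[R]_(1 + m) :=
  block_mx (const_mx ((6 - 2 * n%:R) / (n%:R - 1))) (const_mx (n%:R - 1)^-1)
    (const_mx (n%:R - 1)^-1)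
    (- 2^-1 *: cycle_lap_mx + const_mx (4 * (n%:R - 1))^-1).

Lemma wheel_inv_mxE : - 2^-1 *: special_laplacian R n
    + (4 / (n%:R - 1)) *: (wheel_w R n *m (wheel_w R n)^T) = wheel_inv_mx.
Proof.
rewrite /wheel_w scale_col_mx tr_col_mx mul_col_row special_laplacianE.
rewrite !scale_block_mx add_block_mx.
congr block_mx; apply/matrixP => i j.
- by rewrite !mxE big_ord1 !mxE !ord1 eqxx mulr1n; field.
- by rewrite !mxE big_ord1 !mxE; field.
- by rewrite !mxE big_ord1 !mxE; field.
by rewrite !mxE big_ord1 !mxE; field.
Qed.

Lemma mul_wheel_dist_inv : wheel_dist_mx R n *m wheel_inv_mx = 1%:M.
Proof.
have sum_const (c : R) : \sum_(j < m) c = (n%:R - 1) * c.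
  by rewrite sumr_const card_ord -natm mulr_natl.
have invE a b : (- 2^-1 *: cycle_lap_mx + const_mx (4 * (n%:R - 1))^-1) a b
    = - 2^-1 * cycle_lap_mx a b + (4 * (n%:R - 1))^-1.
  by rewrite mxE [X in X + _]mxE [X in _ + X]mxE.
rewrite wheel_dist_mxE mulmx_block (@scalar_mx_block _ 1 m).
congr block_mx; apply/matrixP => i j; rewrite !mxE ?big_ord1.
- under [X in _ + X]eq_bigr do rewrite !mxE.
  by rewrite sum_const !mxE !ord1 eqxx mulr1n; field.
(* The columns of the cycle block sum to [- 1 / 4 + 1 / 4 = 0]. *)
- under [X in _ + X]eq_bigr do rewrite [X in X * _]mxE mul1r invE.
  rewrite big_split -mulr_sumr sum_cycle_lap /= sum_const !mxE.
  by field.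
- under eq_bigr do rewrite [X in _ * X]mxE.
  rewrite sum_cycle_dist sum_const !mxE.
  by field.
under eq_bigr do rewrite invE.
rewrite sum_cycle_dist.
rewrite big_split -mulr_sumr sum_cycle_lap /= sum_const.
rewrite ![const_mx _ _ _]mxE.
have := lap_coef_rec i j.
move: (cycle_lap_mx i j) (cycle_lap_mx (ordS i) j) (cycle_lap_mx (ord_pred i) j).
move=> x y z xyz.
(* Eliminating one neighbour by the recurrence leaves an identity of rational functions in [n]. *)
have -> : y = 2 * (i == j)%:R - 2 * x - z by rewrite -xyz; ring.
by rewrite -mulr_natr; field.
Qed.

End WheelInverse.

Theorem theorem1 (R : realFieldType) (n : nat)
    (n_ge4 : (4 <= n)%N) (n_even : ~~ odd n) :
  wheel_dist_mx R n \in unitmx /\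
  invmx (wheel_dist_mx R n) =
    - 2^-1 *: special_laplacian R n
    + (4 / (n%:R - 1)) *: (wheel_w R n *m (wheel_w R n)^T).
Proof.
have DN := mul_wheel_dist_inv R n n_ge4 n_even.
(* For square matrices a right inverse already gives invertibility. *)
have [D_unit _] := mulmx1_unit DN; split=> //.
by rewrite wheel_inv_mxE // -[LHS]mulmx1 -DN mulKmx.
Qed.
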